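(* Let $(C,X,F)\sim P_{C,X,F}$ be random elements of standard Borel spaces $\mathcal C,\mathcal X,\mathcal F$, and let $S_X\triangleq P_{F\mid X,C}(\,\cdot\mid X,C)\in\mathcal P(\mathcal F)$. Then: 1. (Predictive sufficiency.) $S_X$ is a function of $(X,C)$ that is an admissible representation, and $$F\perp\!\!\!\perp X\mid (S_X,C).$$ 2. (Minimality.) For every admissible and predictively sufficient representation $T$, with values in a standard Borel space $\mathcal T$, there exists a measurable map $g:\mathcal T\times\mathcal C\to\mathcal P(\mathcal F)$ such that $$S_X=g(T,C)\qquad\text{almost surely}.$$ A valid version is $g(t,c)=P_{F\mid T,C}(\,\cdot\mid t,c)$. Equivalently, $\sigma(S_X,C)\subseteq\sigma(T,C)$ modulo $P$-null sets.
   Context: All random elements take values in standard Borel spaces. For a standard Borel space $\mathcal E$, $\mathcal P(\mathcal E)$ is the set of probability measures on $\mathcal E$ with its evaluation $\sigma$-field (the smallest $\sigma$-field making $\mu\mapsto\mu(A)$ measurable for every measurable $A\subseteq\mathcal E$). One measurable version of each regular conditional distribution is fixed, and identities between kernels hold almost surely. $P_{F\mid X,C}(\,\cdot\mid x,c)$ is the regular conditional distribution of $F$ given $(X,C)=(x,c)$. A possibly randomized representation $T$ (a random element jointly distributed with $(C,X,F)$) is *admissible* if $F-(X,C)-T$ is a Markov chain, i.e. $F$ and $T$ are conditionally independent given $(X,C)$. It is *predictively sufficient* if $F\perp\!\!\!\perp X\mid(T,C)$. An inclusion of $\sigma$-fields modulo $P$ means that every event of the first coincides with an event of the second up to a $P$-null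 set. *)

(* Defs.v *)
From HB Require Import structures.
From mathcomp Require Import all_boot all_order all_algebra.
From mathcomp Require Import all_classical all_reals all_analysis.
From mathcomp Require Import measurable_realfun.

Set Implicit Arguments.
Unset Strict Implicit.
Unset Printing Implicit Defensive.

Import Order.TTheory GRing.Theory Num.Theory.
Import numFieldNormedType.Exports.

Local Open Scope classical_set_scope.
Local Open Scope ring_scope.

Definition polish (R : realType) (Y : metricType R) : Prop :=
  (exists2 D : set Y, countable D & dense D) /\
  (forall G : set_system Y, ProperFilter G -> cauchy G -> exists y : Y, G --> y).

Definition borel (Y : topologicalType) : set (set Y) :=
  <<s [set U : set Y | open U] >>.

(* Mackey's definition: T is isomorphic, as a measurable space, to a Borel
   subset (the range of f) of a Polish space. *)
Definition standard_borel (R : realType) d (T : measurableType d) : Prop :=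
  exists (Y : metricType R) (f : T -> Y),
    [/\ polish Y, injective f, borel (range f) &
        forall A : set T,
          measurable A <-> (exists2 B : set Y, borel B & f @^-1` B = A)].

(* A [probability T R] is a function on all of [set T], so two of them can
   agree on every measurable set and still differ as Rocq terms; the
   sigma-field of [pprobability T R] does not separate such points. Requiring
   the value 0 on nonmeasurable sets selects exactly one term per probability
   measure: [=] on [pmeas T R] is then equality of measures. *)
Record pmeas d (T : measurableType d) (R : realType) := PMeas {
  pmeas_val :> probability T R ;
  pmeasNE : forall A : set T, ~ measurable A -> pmeas_val A = 0%E }.

Section canonical_pmeas.
Local Open Scope ereal_scope.
Context d (T : measurableType d) (R : realType) (P : probability T R).

Definition mtrim (A : set T) : \bar R := if `[< measurable A >] then P A else 0.

Lemma mtrimE A : measurable A -> mtrim A = P A.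
Proof. by move=> mA; rewrite /mtrim asboolT. Qed.

Lemma mtrimNE A : ~ measurable A -> mtrim A = 0.
Proof. by move=> mA; rewrite /mtrim asboolF. Qed.

Let mtrim0 : mtrim set0 = 0.
Proof. by rewrite mtrimE// measure0. Qed.

Let mtrim_ge0 A : 0 <= mtrim A.
Proof. by rewrite /mtrim; case: ifP. Qed.

Let mtrim_sigma_additive : semi_sigma_additive mtrim.
Proof.
move=> F mF tF mUF; rewrite mtrimE//.
under eq_fun do under eq_bigr do rewrite mtrimE//.
exact: measure_semi_sigma_additive.
Qed.

HB.instance Definition _ := isMeasure.Build _ _ _ mtrim
  mtrim0 mtrim_ge0 mtrim_sigma_additive.

Let mtrimT : mtrim [set: T] = 1.
Proof. by rewrite mtrimE// probability_setT. Qed.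

HB.instance Definition _ := Measure_isProbability.Build _ _ _ mtrim mtrimT.

Definition to_pmeas : pmeas T R := @PMeas _ _ _ mtrim mtrimNE.

Lemma to_pmeasE A : measurable A -> to_pmeas A = P A.
Proof. exact: mtrimE. Qed.

End canonical_pmeas.

Lemma probability_ext d (T : measurableType d) (R : realType)
    (P Q : probability T R) : P = Q :> (set T -> \bar R) -> P = Q.
Proof.
case: P Q => [P cP] [Q cQ] /= PQ; rewrite -{Q}PQ in cQ *; congr Probability.Pack.
case: cP cQ => [[a1 a2] [a3] [a4] [a5] [a6] [a7] [a8]].
case=> [[b1 b2] [b3] [b4] [b5] [b6] [b7] [b8]].
case: _ / (Prop_irrelevance a1 b1); case: _ / (Prop_irrelevance a2 b2).
case: _ / (Prop_irrelevance a3 b3); case: _ / (Prop_irrelevance a4 b4).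
case: _ / (Prop_irrelevance a5 b5); case: _ / (Prop_irrelevance a6 b6).
by case: _ / (Prop_irrelevance a7 b7); case: _ / (Prop_irrelevance a8 b8).
Qed.

Lemma pmeas_ext d (T : measurableType d) (R : realType) (mu nu : pmeas T R) :
  (forall A, measurable A -> mu A = nu A) -> mu = nu.
Proof.
case: mu nu => [mu mu0] [nu nu0] /= munu.
have E : mu = nu.
  apply: probability_ext; apply/funext => A.
  by case: (pselect (measurable A)) => mA; [exact: munu|rewrite mu0// nu0].
by case: _ / E nu0 munu => nu0 _; congr PMeas; exact: Prop_irrelevance.
Qed.

HB.instance Definition _ d (T : measurableType d) (R : realType) :=
  gen_eqMixin (pmeas T R).
HB.instance Definition _ d (T : measurableType d) (R : realType) :=
  gen_choiceMixin (pmeas T R).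
HB.instance Definition _ d (T : measurableType d) (R : realType) :=
  isPointed.Build (pmeas T R) (to_pmeas (dirac point)).

Definition evset d (T : measurableType d) (R : realType) :
    set (set (pmeas T R)) :=
  \bigcup_(A in measurable)
    preimage_set_system setT (fun mu : pmeas T R => mu A) measurable.

Definition Pspace d (T : measurableType d) (R : realType) :
    measurableType (evset (T := T) (R := R)).-sigma :=
  g_sigma_algebraType (evset (T := T) (R := R)).

Section conditioning.
Local Open Scope ereal_scope.
Context d (Omega : measurableType d) (R : realType) (P : probability Omega R).

(* [p] is a version of z |-> P(E | Z = z). *)
Definition cond_prob dz (SZ : measurableType dz) (Z : Omega -> SZ)
    (E : set Omega) (p : SZ -> \bar R) : Prop :=
  measurable_fun setT p /\
  forall B : set SZ, measurable B ->
    \int[P]_(w in Z @^-1` B) p (Z w) = P (E `&` Z @^-1` B).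

(* [k] is a version of the regular conditional distribution of U given Z. *)
Definition reg_cond_dist du (SU : measurableType du) dz
    (SZ : measurableType dz) (U : Omega -> SU) (Z : Omega -> SZ)
    (k : SZ -> Pspace SU R) : Prop :=
  measurable_fun setT k /\
  forall A : set SU, measurable A ->
    cond_prob Z (U @^-1` A) (fun z => k z A).

(* P(U in A, V in B | Z) = P(U in A | Z) P(V in B | Z) almost surely, for all
   measurable A and B: since versions of conditional probabilities are unique
   up to null sets, this says that the product of versions is a version. *)
Definition cond_indep du (SU : measurableType du) dv (SV : measurableType dv)
    dz (SZ : measurableType dz)
    (U : Omega -> SU) (V : Omega -> SV) (Z : Omega -> SZ) : Prop :=
  forall (A : set SU) (B : set SV), measurable A -> measurable B ->
    exists p q : SZ -> \bar R,
      [/\ cond_prob Z (U @^-1` A) p,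
          cond_prob Z (V @^-1` B) q &
          cond_prob Z (U @^-1` A `&` V @^-1` B) (fun z => p z * q z)].

Definition sigma_sub_mod du (SU : measurableType du) dv
    (SV : measurableType dv) (U : Omega -> SU) (V : Omega -> SV) : Prop :=
  forall A : set Omega, g_sigma_algebra_preimage U A ->
    exists2 B : set Omega, g_sigma_algebra_preimage V B & P (A `+` B) = 0.

Context dc (SC : measurableType dc) dx (SX : measurableType dx)
  df (SF : measurableType df) dt (ST : measurableType dt).

(* Randomized representations are covered because Omega is arbitrary: T may
   depend on more of w than C w, X w and F w. *)
Definition admissible (C : Omega -> SC) (X : Omega -> SX) (F : Omega -> SF)
    (T : Omega -> ST) : Prop :=
  [/\ standard_borel R ST, measurable_fun setT T &
      cond_indep F T (fun w => (X w, C w))].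

Definition predictively_sufficient (C : Omega -> SC) (X : Omega -> SX)
    (F : Omega -> SF) (T : Omega -> ST) : Prop :=
  cond_indep F X (fun w => (T w, C w)).

End conditioning.

(* Main.v *)
(* Every standard Borel space is a measurable retract of the space of bit
   sequences: code a point of a Polish space by the balls of a countable base
   that contain it; the codes are the sequences describing a Cauchy filter of
   balls, which is a countable condition. A consistent assignment of masses to
   cylinders is the law of the bit sequence obtained from a uniform variable by
   bisecting [0, 1[ in proportion to the masses. This construction depends
   measurably on the masses, so it yields both regular conditional distributions
   and a retraction of the bit sequences onto P(F), which is therefore standard
   Borel. Finally, if T is admissible then the law of F given (X, C, T) is S_X;
   if T is predictively sufficient it is also P(F | T, C), so the two agree. *)
Require Import Defs.
From HB Require Import structures.
From mathcomp Require Import all_boot all_order all_algebra.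
From mathcomp Require Import all_classical all_reals all_analysis.
From mathcomp Require Import measurable_realfun.
From mathcomp Require Import ring lra.

Set Implicit Arguments.
Unset Strict Implicit.
Unset Printing Implicit Defensive.

Import Order.TTheory GRing.Theory Num.Theory.
Import numFieldNormedType.Exports.

Local Open Scope classical_set_scope.
Local Open Scope ring_scope.

(** * Bit sequences and the real line *)

Definition bitset : set (set (nat -> bool)) :=
  range (fun n => [set z : nat -> bool | z n]).

Definition bits := g_sigma_algebraType bitset.

Lemma measurable_bit n : measurable [set z : bits | z n].
Proof. by apply: sub_sigma_algebra; exists n. Qed.

Lemma measurable_fun_bit n : measurable_fun [set: bits] (fun z : bits => z n).
Proof.
apply: (measurable_fun_bool true) => //.
by rewrite setTI preimage_true; exact: measurable_bit.
Qed.

Lemma measurable_fun_bits d (T : measurableType d) (f : T -> bits) :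
  (forall n, measurable [set t | f t n]) -> measurable_fun setT f.
Proof.
move=> mf; apply: (@measurability _ _ T bits setT f bitset) => //.
by move=> _ [_ [n _ <-] <-]; rewrite setTI; exact: mf.
Qed.

(** A working form of [standard_borel], shown below to be equivalent to it. Since the left inverse
    [c] is total, laws on [bits] can be carried back to [T] by a mere push-forward. *)
Definition bits_retract d (T : measurableType d) : Prop :=
  exists (b : T -> bits) (c : bits -> T),
    [/\ measurable_fun setT b, measurable_fun setT c & cancel b c].

Section ternary.
Context {R : realType}.
Implicit Types z : bits.

(** The digits are 0 or 1 but the base is 3: everything after a digit adds up to at most half the
    weight of that digit, so the value determines the sequence, which fails in base 2. *)
Definition tern_sum z n : R := \sum_(i < n) (z i)%:R / 3 ^+ i.+1.

Definition tern z : R := limn (tern_sum z).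

Definition bshift z : bits := fun k => z k.+1.

Lemma tern_sumS z n :
  tern_sum z n.+1 = ((z 0)%:R + tern_sum (bshift z) n) / 3.
Proof.
rewrite /tern_sum big_ord_recl /= expr1 mulrDl; congr +%R.
rewrite mulr_suml; apply: eq_bigr => i _.
by rewrite /bump /= add1n -mulrA -invfM -exprSr.
Qed.

Lemma tern_sum_ge0 z n : 0 <= tern_sum z n.
Proof. by apply: sumr_ge0 => i _; rewrite divr_ge0 ?exprn_ge0. Qed.

Lemma tern_sum_le z n : tern_sum z n <= 2^-1.
Proof.
elim: n z => [|n ih] z; first by rewrite /tern_sum big_ord0 invr_ge0.
rewrite tern_sumS; have := ih (bshift z).
have : (z 0)%:R <= 1 :> R by case: (z 0).
lra.
Qed.

Lemma tern_cvg z : tern_sum z @ \oo --> tern z.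
Proof.
apply: nondecreasing_is_cvgn.
  apply/nondecreasing_seqP => n.
  by rewrite /tern_sum big_ord_recr /= lerDl divr_ge0 ?exprn_ge0.
by exists 2^-1 => _ [n _ <-]; exact: tern_sum_le.
Qed.

Lemma tern_ge0 z : 0 <= tern z.
Proof.
apply: limr_ge; first exact: tern_cvg.
by apply: nearW => n; exact: tern_sum_ge0.
Qed.

Lemma tern_le z : tern z <= 2^-1.
Proof.
apply: limr_le; first exact: tern_cvg.
by apply: nearW => n; exact: tern_sum_le.
Qed.

Lemma ternS z : 3 * tern z = (z 0)%:R + tern (bshift z).
Proof.
suff -> : tern z = ((z 0)%:R + tern (bshift z)) / 3 by rewrite mulrC divfK.
have h : (fun n => tern_sum z n.+1) @ \oo --> tern z.
  by rewrite (cvg_shiftS (tern_sum z)); exact: tern_cvg.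
rewrite -(cvg_lim _ h)//; apply: cvg_lim => //.
under eq_fun do rewrite tern_sumS.
apply: cvgMl; apply: cvgD; [exact: cvg_cst|exact: tern_cvg].
Qed.

Lemma measurable_tern : measurable_fun setT tern.
Proof.
apply: (@measurable_fun_cvg _ _ R setT (fun n z => tern_sum z n)); last first.
  by move=> z _; exact: tern_cvg.
move=> n; apply: measurable_sum => i.
apply: measurable_funM => //.
apply: (measurableT_comp (f := fun b : bool => b%:R : R)) => //.
exact: measurable_fun_bit.
Qed.

Fixpoint tern_rem (r : R) n : R :=
  if n is m.+1 then 3 * tern_rem r m - (1 <= 3 * tern_rem r m)%R%:R else r.

Definition tern_digits r : bits := fun n => 1 <= 3 * tern_rem r n.

(** By [ternS], three times the value is the first bit plus a number in [0, 1/2], so comparison with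
    1 reads that bit. Subtracting it leaves the value of the shifted sequence, and the extraction
    repeats. *)
Lemma ternK : cancel tern tern_digits.
Proof.
have digit z : (1 <= 3 * tern z) = z 0.
  rewrite ternS; have := tern_ge0 (bshift z); have := tern_le (bshift z).
  by case: (z 0) => /= ? ?; [apply/idP|apply/negP]; lra.
have remE z n : tern_rem (tern z) n = tern (fun k => z (k + n)%N).
  elim: n => [|n /= ->]; first by congr tern; apply/funext => k; rewrite addn0.
  rewrite digit ternS addrAC subrr add0r; congr tern.
  by apply/funext => k; rewrite /bshift addSnnS.
by move=> z; apply/funext => n; rewrite /tern_digits remE digit.
Qed.

Lemma measurable_tern_digits : measurable_fun setT tern_digits.
Proof.
have mrem n : measurable_fun setT (fun r => tern_rem r n).
  elim: n => [|n ih] /=; first exact: measurable_id.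
  apply: measurable_funB; first exact: measurable_funM.
  apply: (measurableT_comp (f := fun b : bool => b%:R : R)) => //.
  by apply: measurable_fun_ler => //; exact: measurable_funM.
apply: measurable_fun_bits => n.
rewrite -[X in measurable X]setTI -preimage_true.
apply: (_ : measurable_fun setT (tern_digits^~ n)) => //.
by apply: measurable_fun_ler => //; exact: measurable_funM.
Qed.

End ternary.

Lemma borelE_realType (R : realType) : @borel R^o = @measurable _ R.
Proof.
apply/seteqP; split => A.
  apply: smallest_sub; first exact: sigma_algebra_measurable.
  by move=> U; exact: open_measurable.
suff : (@ocitv R).-sigma.-measurable `<=` @borel R^o by apply.
rewrite RGenOpens.measurableE.
apply: smallest_sub; first exact: smallest_sigma_algebra.
by move=> _ [x [y ->]]; apply: sub_sigma_algebra; exact: itv_open.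
Qed.

Lemma polish_realType (R : realType) : @polish R R^o.
Proof.
split.
  exists (range (@ratr R)); last exact: dense_rat.
  by apply: card_le_trans (card_image_le _ _) _; exact: countableP.
move=> G PG cG; exists (lim G).
exact: (@cauchy_cvg R^o).
Qed.

Lemma bits_retract_standard_borel (R : realType) d (T : measurableType d) :
  bits_retract T -> standard_borel R T.
Proof.
move=> [b [c [mb mc bK]]].
have mtb : measurable_fun setT (tern (R := R) \o b).
  exact: measurableT_comp measurable_tern mb.
have mct : measurable_fun setT (c \o tern_digits (R := R)).
  exact: measurableT_comp mc measurable_tern_digits.
have tbK : cancel (tern (R := R) \o b) (c \o tern_digits (R := R)).
  by move=> t; rewrite /= ternK.
exists R^o, (tern \o b); rewrite borelE_realType; split.
- exact: polish_realType.
- exact: can_inj tbK.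
(* The range of a map with a left inverse is the set of fixed points of embedding after retraction;
   both being measurable, that set is Borel. *)
- suff -> : range (tern (R := R) \o b) =
      [set r | tern (b (c (tern_digits r))) - r = 0].
    rewrite -[X in measurable X]setTI.
    have mh : measurable_fun setT
        (fun r : R => tern (b (c (tern_digits r))) - r).
      by apply: measurable_funB => //; exact: measurableT_comp mtb mct.
    exact: (mh measurableT [set 0]).
  apply/seteqP; split => [_ [t _ <-]|r /subr0_eq <-].
    by rewrite /= ternK bK subrr.
  by eexists.
- move=> A; split => [mA|[B mB <-]].
    exists ((c \o tern_digits) @^-1` A).
      by rewrite -[X in measurable X]setTI; exact: mct.
    by apply/seteqP; split => t; rewrite /= ternK bK.
  by rewrite -[X in measurable X]setTI; exact: mtb.
Qed.

(** * Coding Polish spaces by bit sequences *)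

Section formal_balls.
Context {R : realType} {Y : metricType R}.
Variables (u : nat -> Y) (r : nat -> R).
Hypothesis r_gt0 : forall n, 0 < r n.
Hypothesis u_dense : forall (y : Y) (e : R), 0 < e ->
  exists n, r n < e /\ mdist (u n) y < r n.
Hypothesis Y_complete : forall G : set_system Y, ProperFilter G -> cauchy G ->
  exists y : Y, G --> y.

Let U n := [set y | mdist (u n) y < r n].

(** Formal strict inclusion of balls. It implies inclusion with positive slack, and compares only
    centers and radii. *)
Let below j n := mdist (u j) (u n) + r j < r n.

Definition ball_code (y : Y) : bits := fun n => mdist (u n) y < r n.

(** The selected balls form a rounded Cauchy filter: arbitrarily small radii, directedness, upward
    closure. Only indices are quantified, never points of [Y], so the condition is a countable
    combination of bits. *)
Let good (z : bits) : Prop :=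
  [/\ forall k, exists2 n, z n & r n < k.+1%:R^-1,
      forall n m, z n -> z m -> exists2 j, z j & below j n && below j m &
      forall n m, z n -> below n m -> z m].

Let below_trans_mem j n y : below j n -> mdist (u j) y < r j ->
  mdist (u n) y < r n.
Proof.
rewrite /below => jn jy.
by have := metric_triangle (u n) (u j) y; rewrite (metric_sym (u n) (u j)); lra.
Qed.

Let good_code y : good (ball_code y).
Proof.
split => [k|n m zn zm|n m zn nm].
- have [|n [nk yn]] := @u_dense y k.+1%:R^-1; first by rewrite invr_gt0.
  by exists n.
(* Half of the smaller slack: for a ball of radius below [e] containing [y], the distance from its
   center to [y] plus its radius is less than [2 * e]. *)
- pose e := Num.min (r n - mdist (u n) y) (r m - mdist (u m) y) / 2.
  have e0 : 0 < e by rewrite divr_gt0// lt_min !subr_gt0; apply/andP; split.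
  have [j [je yj]] := u_dense y e0; exists j => //.
  have [en em] : 2 * e <= r n - mdist (u n) y /\ 2 * e <= r m - mdist (u m) y.
    by rewrite mulrC divfK//; split; rewrite ge_min lexx ?orbT.
  have := metric_triangle (u j) y (u n); have := metric_triangle (u j) y (u m).
  rewrite (metric_sym y (u n)) (metric_sym y (u m)) /below => ? ?.
  by apply/andP; split; lra.
- exact: below_trans_mem nm zn.
Qed.

(* A good sequence is the trace of the filter generated by its balls; the
   point it codes is the limit of that Cauchy filter. *)
Let good_surj z : good z -> exists y, ball_code y = z.
Proof.
move=> [zsmall zdir zup].
pose G := [set A : set Y | exists2 n, z n & U n `<=` A].
have zsub n j : below j n -> U j `<=` U n.
  by move=> jn y; exact: below_trans_mem.
have small e : 0 < e -> exists2 n, z n & r n < e.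
  move=> e0; have [k ke] : exists k : nat, k.+1%:R^-1 < e.
    exists (Num.truncn e^-1); rewrite invf_plt ?posrE//.
    by have := truncnS_gt e^-1.
  by have [n zn nk] := zsmall k; exists n => //; exact: lt_trans nk ke.
have PG : ProperFilter G.
  split.
    move=> [n zn]; apply: (_ : ~ (U n `<=` set0)).
    by move=> /(_ (u n)); apply; rewrite /U /= mdistxx r_gt0.
  split.
  - by have [n zn _] := small 1 ltr01; exists n.
  - move=> A B [n zn nA] [m zm mB]; have [j zj /andP[jn jm]] := zdir _ _ zn zm.
    exists j => // y jy; split; first exact/nA/(zsub _ _ jn).
    exact/mB/(zsub _ _ jm).
  - by move=> A B AB [n zn nA]; exists n => //; exact: subset_trans nA AB.
have [|y Gy] := Y_complete PG.
  apply/cauchyP => e e0; have [n zn ne] := small e e0.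
  exists (u n); exists n => // x; rewrite /U /= ballEmdist /= => nx.
  exact: lt_trans nx ne.
have near e : 0 < e -> exists2 n, z n & U n `<=` [set x | mdist y x < e].
  move=> e0; have [|n zn nB] := Gy (ball y e); first exact: nbhsx_ballx.
  by exists n => //; rewrite -ballEmdist.
(* A limit is a priori only adherent to the balls. Here the slack between [j] and [n] absorbs the
   distance from [y] to a center [u l] lying in ball [j]. *)
have zU n : z n -> mdist (u n) y < r n.
  move=> zn; have [j zj /andP[jn _]] := zdir _ _ zn zn.
  have e0 : 0 < r n - (mdist (u j) (u n) + r j) by rewrite subr_gt0.
  have [k zk kB] := near _ e0; have [l zl /andP[lj lk]] := zdir _ _ zj zk.
  have := kB _ (zsub _ _ lk (u l) _).
  have := zsub _ _ lj (u l); rewrite /U /= mdistxx r_gt0.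
  move=> /(_ isT) jl /(_ isT) yl.
  have := metric_triangle (u n) (u j) y; have := metric_triangle (u j) (u l) y.
  rewrite (metric_sym (u n) (u j)) (metric_sym (u l) y); lra.
exists y; apply/funext => n; apply/idP/idP; last exact: zU.
rewrite /ball_code => ny.
(* A selected ball of radius below half the slack contains [y] by [zU], hence is formally below ball
   [n]; upward closure then selects [n]. *)
have e0 : 0 < (r n - mdist (u n) y) / 2 by rewrite divr_gt0// subr_gt0.
have [m zm me] := small _ e0; apply: (zup m) => //.
have := zU _ zm; have := metric_triangle (u m) y (u n).
rewrite (metric_sym y (u n)) /below; lra.
Qed.

Let measurable_good : measurable [set z | good z].
Proof.
have -> : [set z | good z] =
   (\bigcap_k \bigcup_(n in [set n | r n < k.+1%:R^-1])
     [set z : bits | z n]) `&`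
   (\bigcap_n \bigcap_m (~` ([set z : bits | z n] `&` [set z : bits | z m]) `|`
     \bigcup_(j in [set j | below j n && below j m]) [set z : bits | z j])) `&`
   (\bigcap_n \bigcap_(m in below n) (~` [set z : bits | z n] `|`
     [set z : bits | z m])).
  apply/seteqP; split => z.
    move=> [zsmall zdir zup]; split; first split.
    - by move=> k _; have [n zn nk] := zsmall k; exists n.
    - move=> n _ m _; have [zn|/negP nzn] := boolP (z n); last by left => -[].
      have [zm|/negP nzm] := boolP (z m); last by left => -[].
      by have [j ? ?] := zdir n m zn zm; right; exists j.
    - move=> n _ m nm; have [zn|/negP] := boolP (z n); last by left.
      by right; exact: zup nm.
  move=> [[zsmall zdir] zup]; split => [k|n m zn zm|n m zn nm].
  - by have [n ? ?] := zsmall k I; exists n.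
  - by have [|[j ? ?]] := zdir n I m I; [case|exists j].
  - by have [|] := zup n I m nm.
apply: measurableI; first apply: measurableI.
- apply: bigcapT_measurable => k; apply: bigcup_measurable => n _.
  exact: measurable_bit.
- apply: bigcapT_measurable => n; apply: bigcapT_measurable => m.
  apply: measurableU.
    by apply/measurableC/measurableI; exact: measurable_bit.
  by apply: bigcup_measurable => j _; exact: measurable_bit.
- apply: bigcapT_measurable => n; apply: bigcap_measurableType => m _.
  by apply: measurableU; [apply: measurableC|]; exact: measurable_bit.
Qed.

Lemma ball_code_inj : injective ball_code.
Proof.
move=> x y xy; apply: mdist_positivity; apply/eqP.
rewrite eq_le mdist_ge0 andbT; apply/ler_addgt0Pl => e e0.
have e20 : 0 < e / 2 by rewrite divr_gt0.
have [n [ne xn]] := u_dense x e20.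
have yn : mdist (u n) y < r n.
  by have /(congr1 (@^~ n)) := xy; rewrite /ball_code xn.
have := metric_triangle x (u n) y; rewrite (metric_sym x (u n)); lra.
Qed.

Let range_code : range ball_code = [set z | good z].
Proof.
apply/seteqP; split => [_ [y _ <-]|z /good_surj[y <-]]; first exact: good_code.
by exists y.
Qed.

(** The sets with measurable image form a sigma-field: complements are handled by injectivity and
    measurability of the range, which consists of the good sequences. An open set is a union of
    balls of the base, and membership in such a ball is a single bit of the code. *)
Lemma measurable_ball_code_image (B : set Y) :
  borel B -> measurable (ball_code @` B).
Proof.
move: B; suff : @borel Y `<=` [set B | measurable (ball_code @` B)] by apply.
apply: smallest_sub; first split => /=.
- by rewrite image_set0.
- move=> A mA.
  have -> : ball_code @` (setT `\` A) = range ball_code `\` ball_code @` A.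
    apply/seteqP; split => [_ [y [_ Ay] <-]|_ [[y _ <-] Ay]].
      split; first by exists y.
      by move=> [x Ax /ball_code_inj xy]; apply: Ay; rewrite -xy.
    by exists y => //; split => // yA; apply: Ay; exists y.
  by apply: measurableD => //; rewrite range_code.
- by move=> F mF; rewrite image_bigcup; exact: bigcupT_measurable.
move=> V; rewrite openE /= => oV.
have -> : ball_code @` V = \bigcup_(n in [set n | U n `<=` V])
    ([set z | good z] `&` [set z : bits | z n]).
  apply/seteqP; split => [_ [y Vy <-]|z [n nV [/good_surj[y <-] yn]]].
    have := oV _ Vy; rewrite /interior /= => /nbhs_ballP[e /= e0 eV].
    have e20 : 0 < e / 2 by rewrite divr_gt0.
    have [n [ne yn]] := u_dense y e20; exists n.
      move=> x nx; apply: eV; rewrite ballEmdist /=.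
      move: nx; rewrite /U /=.
      by have := metric_triangle y (u n) x; rewrite (metric_sym y (u n)); lra.
    by split; [exact: good_code|].
  by exists y => //; exact: nV.
apply: bigcup_measurable => n _; apply: measurableI => //.
exact: measurable_bit.
Qed.

End formal_balls.

Lemma standard_borel_bits_retract (R : realType) d (T : measurableType d) :
  standard_borel R T -> bits_retract T.
Proof.
move=> [Y [f [[[D cD dD] Y_complete] f_inj f_range f_meas]]].
have D0 : D !=set0.
  by have [|y [_ Dy]] := dD setT _ openT; [exists (f point)|exists y].
have [v vD] : exists v : nat -> Y, D `<=` range v.
  have [y0 _] := D0; have /countable_injP[g g_inj] := cD.
  (* An index that codes no point of [D] is sent to the default point [y0]. *)
  exists (fun n => xget y0 [set y | D y /\ g y = n]) => y Dy.
  exists (g y) => //; case: xgetP => [x _ [Dx gxy]|/(_ y)[]]; last by split.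
  by apply: g_inj; rewrite ?inE.
(* Each index codes the number of a center and the [k] of a radius 1/(k+1); indices that are not
   codes default to the pair (0, 0). *)
pose idx n : nat * nat := odflt (0, 0)%N (unpickle n).
pose u n := v (idx n).1; pose r n : R := (idx n).2.+1%:R^-1.
have r_gt0 n : 0 < r n by rewrite invr_gt0.
have u_dense (y : Y) e : 0 < e -> exists n, r n < e /\ mdist (u n) y < r n.
  move=> e0; have [k ke] : exists k : nat, k.+1%:R^-1 < e.
    exists (Num.truncn e^-1); rewrite invf_plt ?posrE//.
    exact: truncnS_gt.
  have k0 : 0 < k.+1%:R^-1 :> R by rewrite invr_gt0.
  have [|x [/= yx /vD[i _ vx]]] := dD _ _ (open_interior (ball y k.+1%:R^-1)).
    by exists y; exact: nbhsx_ballx.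
  exists (pickle (i, k)); rewrite /u /r /idx pickleK /=; split=> //.
  rewrite vx metric_sym.
  by have := interior_subset yx; rewrite ballEmdist.
pose b t : bits := ball_code u r (f t).
have b_inj : injective b.
  by move=> s t /(ball_code_inj u_dense)/f_inj.
have b_image A : measurable A -> measurable (b @` A).
  move=> /f_meas[B mB fBA].
  have -> : b @` A = ball_code u r @` B `&` ball_code u r @` range f.
    rewrite -fBA; apply/seteqP; split => [_ [t Bt <-]|z [[y By <-]]].
      by split; [exists (f t)|exists (f t) => //; exists t].
    move=> [_ [t _ <-] /(ball_code_inj u_dense) fty].
    by exists t; rewrite /b /= fty.
  by apply: measurableI; exact: measurable_ball_code_image.
have open_ball (y : Y) e : open (ball y e).
  rewrite openE => x; rewrite ballEmdist /= => yx.
  apply/nbhs_ballP; exists (e - mdist y x); first by rewrite /= subr_gt0.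
  move=> w; rewrite ballEmdist /=.
  by have := metric_triangle y x w; lra.
exists b, (fun z => if pselect (exists t, b t = z) is left e then
  projT1 (cid e) else point); split.
- apply: measurable_fun_bits => n; apply/f_meas.
  exists (ball (u n) (r n)).
    by apply: sub_sigma_algebra; exact: open_ball.
  by rewrite ballEmdist.
- move=> _ A mA; rewrite setTI.
  have mb : measurable (range b) by exact: b_image.
  (* The retraction sends everything off the range of [b] to [point], so the complement of the range
     belongs to the preimage of [A] exactly when [A] contains [point]. *)
  have [ptA|ptA] := pselect (A point).
    rewrite (_ : _ @^-1` _ = b @` A `|` ~` range b).
      by apply: measurableU; [exact: b_image|exact: measurableC].
    apply/seteqP; split => z /=.
      case: pselect => [e|ne _]; last first.
        by right => -[t _ bt]; apply: ne; exists t.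
      by case: cid => t /= <- At; left; exists t.
    case: pselect => [e [[t At bt]|[]]|//].
      by case: cid => s /=; rewrite -bt => /b_inj ->.
    by case: e => t <-; exists t.
  rewrite (_ : _ @^-1` _ = b @` A); first exact: b_image.
  apply/seteqP; split => z /=.
    case: pselect => [e|//].
    by case: cid => t /= <- At; exists t.
  move=> [t At <-]; case: pselect => [e|[]]; last by exists t.
  by case: cid => s /= /b_inj ->.
- move=> t; case: pselect => [e|[]]; last by exists t.
  by case: cid => s /= /b_inj ->.
Qed.

(** * Measures on bit sequences *)

Fixpoint bits_take (z : bits) n : seq bool :=
  if n is k.+1 then z k :: bits_take z k else [::].

(* Finite words are read backwards: the head of [s] is the last bit. *)
Definition cyl (s : seq bool) : set bits := [set z | bits_take z (size s) = s].

Lemma size_bits_take z n : size (bits_take z n) = n.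
Proof. by elim: n => //= n ->. Qed.

Lemma cyl_nil : cyl [::] = setT. Proof. by apply/seteqP; split. Qed.

Lemma cyl_cons b s : cyl (b :: s) = cyl s `&` [set z | z (size s) = b].
Proof. by apply/seteqP; split => z; rewrite /cyl /= => -[] -> ->. Qed.

Lemma measurable_cyl s : measurable (cyl s).
Proof.
elim: s => [|b s ih]; first by rewrite cyl_nil; exact: measurableT.
rewrite cyl_cons; apply: measurableI => //; case: b.
  exact: measurable_bit.
rewrite (_ : [set z | _] = ~` [set z : bits | z (size s)]).
  by apply: measurableC; exact: measurable_bit.
by apply/seteqP; split => z /=; [move=> ->|move=> /negP/negbTE].
Qed.

Lemma bits_take_le z m n : (m <= n)%N ->
  bits_take z m = drop (n - m) (bits_take z n).
Proof.
elim: n => [|n ih]; first by rewrite leqn0 => /eqP ->.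
rewrite leq_eqVlt => /predU1P[->|]; first by rewrite subnn drop0.
by rewrite ltnS => mn; rewrite subSn//= ih.
Qed.

Lemma cylI s t : cyl s `&` cyl t = set0 \/ exists r, cyl s `&` cyl t = cyl r.
Proof.
wlog st : s t / (size s <= size t)%N.
  move=> H; case: (leqP (size s) (size t)) => [|/ltnW]; first exact: H.
  by rewrite setIC; exact: H.
(* Words being stored backwards, the initial bits of [t] are its tail, reached by [drop]. *)
have [ts|ts] := eqVneq (drop (size t - size s) t) s.
  right; exists t; apply/seteqP; split => z; rewrite /cyl /=; first by case.
  move=> zt.
  by split => //; rewrite (bits_take_le _ st) zt.
left; rewrite -subset0 => z; rewrite /cyl /= => -[zs zt]; case/eqP: ts.
by rewrite -[RHS]zs (bits_take_le _ st) zt.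
Qed.

Lemma countType_bigcup_measurable d (T : measurableType d) (I : countType)
    (P : set I) (F : I -> set T) : (forall i, P i -> measurable (F i)) ->
  measurable (\bigcup_(i in P) F i).
Proof.
move=> mF; rewrite bigcup_mkcond; apply: countable_bigcupT_measurable => [|i].
  exact: countableP.
by case: ifPn => [/set_mem|_]; [exact: mF|exact: measurable0].
Qed.

(** Trades single bits for a generating family stable under intersection, as uniqueness of measures
    demands; [set0] is there because incompatible cylinders are disjoint. *)
Lemma measurable_bitsE :
  @measurable _ bits = <<s [set A | A = set0 \/ exists s, A = cyl s] >>.
Proof.
apply/seteqP; split => A.
  apply: smallest_sub; first exact: smallest_sigma_algebra.
  move=> _ [n _ <-].
  have -> : [set z : bits | z n] = 
    \bigcup_(s in [set s | size s = n]) cyl (true :: s).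
    apply/seteqP; split => [z zn|z [s sn]].
      by exists (bits_take z n); rewrite /cyl /= size_bits_take// zn.
    by rewrite cyl_cons sn => -[].
  apply: (@countType_bigcup_measurable _ (g_sigma_algebraType
    [set A | A = set0 \/ exists s, A = cyl s])) => s _.
  apply: sub_sigma_algebra.
  by right; exists (true :: s).
apply: smallest_sub; first exact: sigma_algebra_measurable.
by move=> _ [->|[s ->]]; [exact: measurable0|exact: measurable_cyl].
Qed.

Lemma bits_measure_unique (R : realType)
    (mu nu : {measure set bits -> \bar R}) :
  (mu setT < +oo)%E -> (forall s, mu (cyl s) = nu (cyl s)) ->
  forall A, measurable A -> mu A = nu A.
Proof.
move=> muoo munu A; rewrite measurable_bitsE => mA.
apply: (g_sigma_algebra_measure_unique
  [set A | A = set0 \/ exists s, A = cyl s] _ (fun=> setT)) => //.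
- by move=> _ [->|[s ->]]; [exact: measurable0|exact: measurable_cyl].
- by move=> _; right; exists [::]; rewrite cyl_nil.
- by apply: bigcup_const; exists 0%N.
- move=> A1 A2 [->|[s ->]]; first by rewrite set0I; left.
  case=> [->|[t ->]]; first by rewrite setI0; left.
  exact: cylI.
- move=> _ [->|[s ->]]; last exact: munu.
  exact: etrans (measure0 _) (esym (measure0 _)).
Qed.

Section unit_lebesgue.
Context {R : realType}.

Let mI : measurable (`[0, 1[%classic : set R) := measurable_itv _.

(* The type of [lebesgue_measure] is headed by the generated sigma-algebra of
   half-open intervals; this copy is a measure on [R] for unification. *)
Definition unit_lebesgue (A : set R) : \bar R := mrestr lebesgue_measure mI A.

Let unit_lebesgue0 : unit_lebesgue set0 = 0%E.
Proof. exact: measure0. Qed.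

Let unit_lebesgue_ge0 A : (0 <= unit_lebesgue A)%E.
Proof. exact: measure_ge0. Qed.

Let unit_lebesgue_sigma_additive : semi_sigma_additive unit_lebesgue.
Proof.
exact: (@measure_semi_sigma_additive _ _ _ (mrestr lebesgue_measure mI)).
Qed.

HB.instance Definition _ := isMeasure.Build _ R _ unit_lebesgue
  unit_lebesgue0 unit_lebesgue_ge0 unit_lebesgue_sigma_additive.

Let unit_lebesgueT : unit_lebesgue setT = 1%E.
Proof.
rewrite /unit_lebesgue /mrestr setTI /= lebesgue_measure_itv /= lte01.
by rewrite -EFinB subr0.
Qed.

HB.instance Definition _ :=
  Measure_isProbability.Build _ _ _ unit_lebesgue unit_lebesgueT.

End unit_lebesgue.

(** * Bisection of [0, 1[ in proportion to given masses *)

Section bisection.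
Context {R : realType}.
Implicit Types (m : seq bool -> R) (u : R).

(** The word [s] owns the cell of length [m s] starting here. Its left part, of length
    [m (false :: s)], goes to the next bit [false], hence the offset of the [true] cell. *)
Fixpoint cell_left m s : R :=
  if s is b :: s' then cell_left m s' + (if b then m (false :: s') else 0)
  else 0.

Fixpoint bisect_path m u n : seq bool :=
  if n is k.+1 then
    let s := bisect_path m u k in
    (cell_left m s + m (false :: s) <= u) :: s
  else [::].

Definition bisect m u : bits := fun n => head false (bisect_path m u n.+1).

Lemma bits_take_bisect m u n : bits_take (bisect m u) n = bisect_path m u n.
Proof. by elim: n => //= n ->. Qed.

Definition consistent m := [/\ m [::] = 1, forall s, 0 <= m s &
  forall s, m s = m (false :: s) + m (true :: s)].

(** Induction on the word: inside the cell of [s], the next bit compares [u] with the splitting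
    point, and consistency says that the two parts fill the cell exactly. *)
Lemma bisect_cyl m s : consistent m ->
  bisect m @^-1` cyl s `&` `[0, 1[ =
  `[cell_left m s, cell_left m s + m s[%classic.
Proof.
move=> [m0 m_ge0 mS]; elim: s => [|b s ih].
  by rewrite cyl_nil preimage_setT setTI /= add0r m0.
rewrite cyl_cons preimage_setI setIAC ih.
have := m_ge0 (false :: s); have := m_ge0 (true :: s); have := mS s.
move=> ms mt mf.
have bitE u : cell_left m s <= u < cell_left m s + m s ->
    bisect m u (size s) = (cell_left m s + m (false :: s) <= u).
  move=> su; rewrite /bisect /= -[X in cell_left m X]bits_take_bisect.
  rewrite -[X in false :: X]bits_take_bisect.
  have : [set` `[cell_left m s, cell_left m s + m s[] u by rewrite /= in_itv.
  by rewrite -ih => -[] /= ->.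
apply/seteqP; split => u /=; rewrite !in_itv /=.
  move=> [su]; rewrite bitE//; case: b; last by move/negbT; rewrite -ltNge; lra.
  by move=> ?; apply/andP; split=> //; move: su; lra.
case: b => su; (have su' : cell_left m s <= u < cell_left m s + m s by lra);
  (split; first by []); rewrite bitE//; first lra.
by apply/negbTE; rewrite -ltNge; lra.
Qed.

(** A finite path is decided by finitely many comparisons between [u] and sums of masses.
    Measurability is joint in parameter and point so that Fubini applies to the sections. *)
Lemma measurable_bisect d (T : measurableType d) (m : T -> seq bool -> R) :
  (forall s, measurable_fun setT (m ^~ s)) ->
  measurable_fun setT (fun xu : T * R => bisect (m xu.1) xu.2).
Proof.
move=> mm.
have mleft s : measurable_fun setT (fun x => cell_left (m x) s).
  elim: s => [|b s ih] /=; first exact: measurable_cst.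
  by apply: measurable_funD => //; case: b.
have mpath s : measurable
    [set xu : T * R | bisect_path (m xu.1) xu.2 (size s) = s].
  elim: s => [|b s ih] /=.
    by rewrite (_ : [set _ | _] = setT)//; apply/seteqP.
  rewrite (_ : [set _ | _] =
    [set xu | bisect_path (m xu.1) xu.2 (size s) = s] `&`
    (fun xu : T * R => cell_left (m xu.1) s + m xu.1 (false :: s) <= xu.2)
      @^-1` [set b]).
    apply: measurableI => //; rewrite -[X in measurable X]setTI.
    have : measurable_fun setT (fun xu : T * R =>
        cell_left (m xu.1) s + m xu.1 (false :: s) <= xu.2).
      apply: measurable_fun_ler => //; apply: measurable_funD.
        exact: measurableT_comp (mleft s) measurable_fst.
      exact: measurableT_comp (mm (false :: s)) measurable_fst.
    exact.
  by apply/seteqP; split => xu /=; [move=> [<- ->]|move=> [-> <-]].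
apply: measurable_fun_bits => n.
rewrite (_ : [set _ | _] = \bigcup_(s in [set s | size s = n])
    [set xu | bisect_path (m xu.1) xu.2 (size (true :: s)) = true :: s]).
  by apply: countType_bigcup_measurable => s _; exact: mpath.
apply/seteqP; split => [xu xun|xu [s sn]] /=.
  exists (bisect_path (m xu.1) xu.2 n).
    by rewrite /= -bits_take_bisect size_bits_take.
  rewrite /= -[X in size X]bits_take_bisect size_bits_take.
  by move: xun; rewrite /bisect /= => ->.
by rewrite /= sn /bisect /= => -[-> _].
Qed.

End bisection.

(** * The space of probability measures *)

Section Pspace_measurability.
Context d (T : measurableType d) (R : realType).

Lemma measurable_Pspace_ev (A : set T) : measurable A ->
  measurable_fun setT (fun mu : Pspace T R => mu A).
Proof.
move=> mA _ Y mY; rewrite setTI; apply: sub_sigma_algebra.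
by exists A => //; exists Y => //; rewrite setTI.
Qed.

Lemma measurable_fun_Pspace d' (X : measurableType d') (k : X -> Pspace T R) :
  (forall A, measurable A -> measurable_fun setT (fun x => k x A)) ->
  measurable_fun setT k.
Proof.
move=> mk.
apply: (@measurability _ _ X (Pspace T R) setT k (@evset _ T R)) => //.
move=> _ [_ [A mA [Y mY <-]] <-].
by rewrite !setTI; have := mk A mA measurableT Y mY; rewrite setTI.
Qed.

End Pspace_measurability.

Lemma measurable_bisect1 (R : realType) (m : seq bool -> R) :
  measurable_fun setT (bisect m).
Proof.
have mm : measurable_fun setT (fun xu : R * R => bisect m xu.2).
  exact: (@measurable_bisect _ _ R (fun=> m)).
have mp : measurable_fun setT (fun u : R => (0 : R, u)).
  exact: measurable_fun_pair.
exact: (measurableT_comp mm mp).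
Qed.

HB.instance Definition _ (R : realType) (m : seq bool -> R) :=
  isMeasurableFun.Build _ _ _ _ (bisect m) (measurable_bisect1 m).

Lemma consistent_prob (R : realType) (nu : probability bits R) :
  consistent (fun s => fine (nu (cyl s))).
Proof.
split=> [|s|s]; first by rewrite cyl_nil probability_setT.
  exact: fine_ge0.
have fin b : nu (cyl (b :: s)) \is a fin_num.
  by apply: fin_num_measure; exact: measurable_cyl.
rewrite -fineD//; congr fine; rewrite -measureU; first last.
- rewrite !cyl_cons setIACA setIid.
  rewrite (_ : _ `&` [set z | _ = true] = set0) ?setI0//.
  by apply/seteqP; split=> // z [/= ->].
- exact: measurable_cyl.
- exact: measurable_cyl.
congr (nu _); rewrite !cyl_cons -setIUr (_ : _ `|` _ = setT) ?setIT//.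
apply/seteqP; split=> // z _ /=.
by case: (z _); [right|left].
Qed.

Lemma bisect_lawE_cyl (R : realType) (m : seq bool -> R) s : consistent m ->
  unit_lebesgue (bisect m @^-1` cyl s) = (m s)%:E.
Proof.
move=> cm; have [_ /(_ s) ms _] := cm.
rewrite /unit_lebesgue /mrestr bisect_cyl//= lebesgue_measure_itv /= lte_fin.
(* A word of mass 0 has an empty cell, for which the length formula takes its other branch. *)
rewrite ltrDl; case: ltP => [_|m0]; first by rewrite -EFinB addrAC subrr add0r.
by congr EFin; apply/le_anti/andP.
Qed.

Lemma measurable_bisect_mass (R : realType) d (X : measurableType d)
    (m : X -> seq bool -> R) (D : set bits) :
  (forall s, measurable_fun setT (m ^~ s)) -> measurable D ->
  measurable_fun setT (fun x => unit_lebesgue (bisect (m x) @^-1` D)).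
Proof.
move=> mm mD.
have mG : measurable ((fun xu : X * R => bisect (m xu.1) xu.2) @^-1` D).
  by rewrite -[X in measurable X]setTI; exact: measurable_bisect.
have := measurable_fun_xsection (@unit_lebesgue R) mG.
apply: eq_measurable_fun => x _ /=.
by congr unit_lebesgue; apply/seteqP; split => u; rewrite /xsection /= inE.
Qed.

Section bisect_law.
Context (R : realType) d (T : measurableType d) (c : {mfun bits >-> T}).

(** This is a probability measure for every [m], consistent or not, so kernels built from almost
    surely consistent masses are defined everywhere. *)
Definition bisect_law (m : seq bool -> R) : pmeas T R :=
  to_pmeas (distribution unit_lebesgue (c \o bisect m : {mfun _ >-> T})).

Lemma bisect_lawE m A : measurable A ->
  bisect_law m A = unit_lebesgue (bisect m @^-1` (c @^-1` A)).
Proof. by move=> mA; rewrite /bisect_law to_pmeasE. Qed.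

Lemma measurable_bisect_law d' (X : measurableType d')
    (m : X -> seq bool -> R) :
  (forall s, measurable_fun setT (m ^~ s)) ->
  measurable_fun setT (fun x => bisect_law (m x) : Pspace T R).
Proof.
move=> mm; apply: measurable_fun_Pspace => A mA.
have mcA : measurable (c @^-1` A).
  by rewrite -[X in measurable X]setTI; exact: measurable_funP.
apply: eq_measurable_fun (measurable_bisect_mass mm mcA) => x _.
by rewrite bisect_lawE.
Qed.

(** Transported to [bits], both measures have the same cylinder masses and so coincide; [bK] brings
    the equality back to [T]. A measure is thus encoded by countably many numbers. *)
Lemma bisect_law_id (b : {mfun T >-> bits}) (mu : pmeas T R) : cancel b c ->
  bisect_law (fun s => fine (mu (b @^-1` cyl s))) = mu.
Proof.
move=> bK; apply: pmeas_ext => A mA; rewrite bisect_lawE//.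
have mcA : measurable (c @^-1` A).
  by rewrite -[X in measurable X]setTI; exact: measurable_funP.
have := @bits_measure_unique R (distribution unit_lebesgue (bisect
  (fun s => fine (mu (b @^-1` cyl s))))) (distribution mu b) _ _ _ mcA.
rewrite /distribution /pushforward /= => ->.
- by congr (mu _); apply/seteqP; split => t /=; rewrite bK.
- by rewrite preimage_setT probability_setT ltry.
- move=> s; rewrite bisect_lawE_cyl; last first.
    exact: (consistent_prob (distribution mu b)).
  by rewrite fineK// fin_num_measure// -[X in measurable X]setTI;
    apply: measurable_funP => //; exact: measurable_cyl.
Qed.

End bisect_law.

(** * Coding nonnegative reals by rational cuts *)

Section cuts.
Context {R : realType}.

(* Here the bit of index [(s, q)] encodes whether the mass of [s] exceeds [q];
   clipping at [0] is harmless because masses are nonnegative. *)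
Definition cut_value (z : bits) (s : seq bool) : R :=
  fine (esups (fun n => (if unpickle n is Some q then
    if z (pickle (s, q)) then ratr q else 0 else 0)%:E) 0).

Lemma measurable_cut_value s : measurable_fun setT (cut_value ^~ s).
Proof.
apply: measurableT_comp => //; apply: measurable_fun_esups => n.
apply/measurable_EFinP; case: (unpickle n) => [q|]; last exact: measurable_cst.
apply: measurable_fun_ifT; [exact: measurable_fun_bit|exact: measurable_cst|].
exact: measurable_cst.
Qed.

Lemma cut_valueE z s (v : R) : 0 <= v ->
  (forall q : rat, z (pickle (s, q)) = (ratr q < v)) -> cut_value z s = v.
Proof.
move=> v0 zv; rewrite /cut_value.
suff -> : esups (fun n => (if unpickle n is Some q then
    if z (pickle (s, q)) then ratr q else 0 else 0)%:E) 0 = v%:E by [].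
apply/eqP; rewrite eq_le; apply/andP; split.
  apply: ub_ereal_sup => _ [n _ <-]; rewrite lee_fin.
  by case: (unpickle n) => [q|//]; rewrite zv; case: ifPn => // /ltW.
apply/lee_subgt0Pr => e e0; rewrite -EFinB.
have [|q] := @rat_in_itvoo R (v - e) v; first by rewrite ltrBlDr ltrDl.
rewrite in_itv /= => /andP[/ltW vq qv].
apply: (@le_trans _ _ (ratr q)%:E) => //.
apply: ereal_sup_ubound; exists (pickle q) => //.
by rewrite pickleK zv qv.
Qed.

End cuts.

(** A measure is coded by the rational cuts of its cylinder masses. Decoding recovers the masses as
    suprema and the measure by bisection; both operations make sense, measurably, on every bit
    sequence. *)
Lemma bits_retract_Pspace (R : realType) d (T : measurableType d) :
  bits_retract T -> bits_retract (Pspace T R).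
Proof.
move=> [b [c [mb mc bK]]].
pose b' : {mfun T >-> bits} := HB.pack b (isMeasurableFun.Build _ _ _ _ b mb).
pose c' : {mfun bits >-> T} := HB.pack c (isMeasurableFun.Build _ _ _ _ c mc).
pose mass (mu : Pspace T R) s := fine (mu (b @^-1` cyl s)).
exists (fun mu n => if unpickle n is Some (s, q) then ratr q < mass mu s
  else false), (fun z => bisect_law c' (cut_value z)); split.
- apply: measurable_fun_bits => n; case: (unpickle n) => [[s q]|].
    rewrite -[X in measurable X]setTI.
    have : measurable_fun setT (fun mu => ratr q < mass mu s).
      apply: measurable_fun_ltr => //; apply: measurableT_comp => //.
      apply: measurable_Pspace_ev.
      rewrite -[X in measurable X]setTI.
      exact: (mb measurableT _ (measurable_cyl s)).
    by move=> /(_ measurableT [set true]); exact.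
  rewrite (_ : [set _ | _] = set0); first exact: measurable0.
  by apply/seteqP; split.
- by apply: measurable_bisect_law => s; exact: measurable_cut_value.
- move=> mu; rewrite -[RHS](@bisect_law_id R _ T c' b')//.
  congr bisect_law; apply/funext => s; apply: cut_valueE; first exact: fine_ge0.
  by move=> q; rewrite pickleK.
Qed.

(** * Conditional probabilities *)

Local Open Scope ereal_scope.

Lemma ge0_integral_mrestr d (T : measurableType d) (R : realType)
    (mu : {measure set T -> \bar R}) (E D : set T) (mE : measurable E)
    (f : T -> \bar R) : measurable D -> measurable_fun D f ->
    (forall x, D x -> 0 <= f x) ->
  \int[mrestr mu mE]_(x in D) f x = \int[mu]_(x in D `&` E) f x.
Proof.
move=> mD mf f0; rewrite (@ge0_negligible_integral _ _ _ _ D (~` E))//.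
- rewrite setDE setCK; apply: eq_measure_integral => A _ ADE.
  by rewrite /= /mrestr setIidl//; apply: subset_trans ADE _; exact: subIsetr.
- exact: measurableC.
- by rewrite /= /mrestr setICl measure0.
Qed.

(** A difference is finite only if both terms are, so a finite integral bounds the positive and the
    negative part. This gives integrability of arbitrary versions in [cond_prob], which are only
    assumed measurable. *)
Lemma integrable_of_fin_num d (T : measurableType d) (R : realType)
    (mu : {measure set T -> \bar R}) (D : set T) (f : T -> \bar R) :
  measurable D -> measurable_fun D f -> \int[mu]_(x in D) f x \is a fin_num ->
  mu.-integrable D f.
Proof.
move=> mD mf; rewrite integralE fin_numB => /andP[fp fn].
apply/integrableP; split => //.
  rewrite (_ : (fun x => `|f x|) = f^\+ \+ f^\-); last exact: fune_abse.
  rewrite ge0_integralD//.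
- by rewrite lte_add_pinfty// -ge0_fin_numE// integral_ge0.
- exact: measurable_funepos.
- exact: measurable_funeneg.
Qed.

Section cond_prob.
Context d (Omega : measurableType d) (R : realType) (P : probability Omega R).
Context dz (SZ : measurableType dz) (Z : {mfun Omega >-> SZ}).
Implicit Types (E : set Omega) (B : set SZ) (p q : SZ -> \bar R).

Lemma measurable_mfun_preimage B : measurable B -> measurable (Z @^-1` B).
Proof.
by move=> mB; rewrite -[X in measurable X]setTI; exact: measurable_funP.
Qed.

Section event_law.
Variables (E : set Omega) (mE : measurable E).

(** The finite measure whose density with respect to the law of [Z] is the conditional probability
    of [E]. *)
Definition event_law (B : set SZ) : \bar R := pushforward (mrestr P mE) Z B.

Let event_law0 : event_law set0 = 0.
Proof. exact: measure0. Qed.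

Let event_law_ge0 B : 0 <= event_law B.
Proof. exact: measure_ge0. Qed.

Let event_law_sigma_additive : semi_sigma_additive event_law.
Proof.
exact: (@measure_semi_sigma_additive _ _ _ (pushforward (mrestr P mE) Z)).
Qed.

HB.instance Definition _ := isMeasure.Build _ _ _ event_law
  event_law0 event_law_ge0 event_law_sigma_additive.

Let event_law_fin : fin_num_fun event_law.
Proof.
move=> B mB; rewrite /event_law /pushforward /mrestr.
apply: fin_num_measure; apply: measurableI => //.
exact: measurable_mfun_preimage.
Qed.

HB.instance Definition _ :=
  Measure_isFinite.Build _ _ _ event_law event_law_fin.

Lemma event_law_dominated : event_law `<< distribution P Z.
Proof.
apply/null_content_dominatesP => B mB B0.
apply/eqP; rewrite eq_le measure_ge0 andbT -B0.
rewrite /= /event_law /distribution /pushforward /mrestr.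
apply: le_measure; rewrite ?inE //; last exact: measurable_mfun_preimage.
by apply: measurableI => //; exact: measurable_mfun_preimage.
Qed.

Lemma ge0_integral_event_law f B : measurable_fun setT f ->
  (forall z, 0 <= f z) -> measurable B ->
  \int[event_law]_(z in B) f z = \int[P]_(w in Z @^-1` B `&` E) f (Z w).
Proof.
move=> mf f0 mB.
rewrite -(ge0_integral_mrestr P mE); last 3 first.
- exact: measurable_mfun_preimage.
- by apply: measurable_funTS; exact: measurableT_comp.
- by [].
transitivity (\int[pushforward (mrestr P mE) Z]_(z in B) f z).
  exact: eq_measure_integral.
by rewrite ge0_integral_pushforward//; exact: measurable_funTS.
Qed.

End event_law.

(** Take for [q] the Radon-Nikodym derivative of [event_law] with respect to the law of [Z]; the
    last clause is its change of variables formula. This version is nonnegative and finite at every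
    point. *)
Lemma cond_prob_pull_out E : measurable E -> exists q,
  [/\ forall z, 0 <= q z, forall z, q z \is a fin_num, cond_prob P Z E q &
  forall f B, measurable_fun setT f -> (forall z, 0 <= f z) -> measurable B ->
    \int[P]_(w in Z @^-1` B) (f (Z w) * q (Z w)) =
    \int[P]_(w in Z @^-1` B `&` E) f (Z w)].
Proof.
move=> mE; have dom := event_law_dominated mE.
set q := Radon_Nikodym_SigmaFinite.f (event_law mE) (distribution P Z).
have q0 z : 0 <= q z by exact: Radon_Nikodym_SigmaFinite.f_ge0.
have mq : measurable_fun setT q.
  exact: measurable_int (Radon_Nikodym_SigmaFinite.f_integrable dom).
exists q; split => // [z||f B mf f0 mB].
- exact: Radon_Nikodym_SigmaFinite.f_fin_num.
- split => // B mB.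
  have := Radon_Nikodym_SigmaFinite.f_integral dom mB.
  rewrite ge0_integral_pushforward//; last exact: measurable_funTS.
  by move=> /esym ->; rewrite /= /event_law /pushforward /mrestr setIC.
- have mZB := measurable_mfun_preimage mB.
  have := Radon_Nikodym_SigmaFinite.change_of_variables dom f0 mB
    (measurable_funTS mf).
  rewrite ge0_integral_pushforward//; last 2 first.
  + by apply: emeasurable_funM; exact: measurable_funTS.
  + by move=> z _; exact: mule_ge0.
  by move=> ->; exact: ge0_integral_event_law.
Qed.

(** Under the law of [Z] both versions are integrable with equal integrals over all measurable sets,
    so they agree off a null set, whose preimage by [Z] is null for [P]. *)
Lemma cond_prob_unique E p q : measurable E ->
  cond_prob P Z E p -> cond_prob P Z E q ->
  {ae P, forall w, p (Z w) = q (Z w)}.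
Proof.
move=> mE hp hq; have [[mp pE] [mq qE]] := (hp, hq).
have ip r : cond_prob P Z E r -> forall B, measurable B ->
    P.-integrable (Z @^-1` B) (r \o Z).
  move=> [mr rE] B mB; apply: integrable_of_fin_num.
  - exact: measurable_mfun_preimage.
  - by apply: measurable_funTS; exact: measurableT_comp.
  - rewrite rE//; apply: fin_num_measure; apply: measurableI => //.
    exact: measurable_mfun_preimage.
have : ae_eq (distribution P Z) setT p q.
  apply: integral_ae_eq => //.
    by apply: integrable_pushforward => //; exact: ip.
  move=> B _ mB; rewrite !integral_pushforward//; [|exact: ip|exact: ip].
  by rewrite pE// qE.
move=> [N [mN N0 pqN]]; exists (Z @^-1` N); split => //.
  exact: measurable_mfun_preimage.
by move=> w pq; apply: pqN => /= pqw; apply: pq; exact: pqw.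
Qed.

(** Uniqueness extends the pull-out formula from the Radon-Nikodym derivative to any version. *)
Lemma cond_prob_pull_outE E f q B : measurable E -> cond_prob P Z E q ->
  measurable_fun setT f -> (forall z, 0 <= f z) -> measurable B ->
  \int[P]_(w in Z @^-1` B) (f (Z w) * q (Z w)) =
  \int[P]_(w in Z @^-1` B `&` E) f (Z w).
Proof.
move=> mE qE mf f0 mB; have [q' [_ _ q'E <-//]] := cond_prob_pull_out mE.
have mM r : cond_prob P Z E r ->
    measurable_fun (Z @^-1` B) (fun w => f (Z w) * r (Z w)).
  move=> [mr _]; apply: measurable_funTS.
  by apply: emeasurable_funM; exact: measurableT_comp.
apply: ae_eq_integral; [exact: measurable_mfun_preimage|exact: mM|exact: mM|].
by apply: filterS (cond_prob_unique mE qE q'E) => w -> _.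
Qed.

End cond_prob.

Lemma ae_forall_countType d (T : measurableType d) (R : realType)
    (mu : {measure set T -> \bar R}) (I : countType) (Q : I -> T -> Prop) :
  (forall i, {ae mu, forall x, Q i x}) -> {ae mu, forall x, forall i, Q i x}.
Proof.
move=> aeQ.
have aeQn n : {ae mu, forall x, forall i, unpickle n = Some i -> Q i x}.
  case: (unpickle n) => [j|]; last exact: aeW.
  by apply: filterS (aeQ j) => x Qx i [<-].
apply: filterS (ae_foralln aeQn) => x Qx i.
by apply: (Qx (pickle i)); exact: pickleK.
Qed.

(** * Existence of regular conditional distributions *)

Section reg_cond_dist_exists.
Context d (Omega : measurableType d) (R : realType) (P : probability Omega R).
Context dz (SZ : measurableType dz) (Z : {mfun Omega >-> SZ}).

Lemma cond_prob_setT : cond_prob P Z setT (cst 1).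
Proof.
split=> // B mB; rewrite integral_cst ?mul1e ?setTI//.
exact: measurable_mfun_preimage.
Qed.

Lemma cond_probU E1 E2 p1 p2 : measurable E1 -> measurable E2 ->
  E1 `&` E2 = set0 -> (forall z, 0 <= p1 z) -> (forall z, 0 <= p2 z) ->
  cond_prob P Z E1 p1 -> cond_prob P Z E2 p2 ->
  cond_prob P Z (E1 `|` E2) (p1 \+ p2).
Proof.
move=> mE1 mE2 E12 p10 p20 [mp1 p1E] [mp2 p2E]; split.
  exact: emeasurable_funD.
move=> B mB; have mZB := measurable_mfun_preimage Z mB.
rewrite ge0_integralD//; last 2 first.
- by apply: measurable_funTS; exact: measurableT_comp.
- by apply: measurable_funTS; exact: measurableT_comp.
rewrite p1E// p2E// setIUl measureU//; [exact: measurableI|exact: measurableI|].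
by rewrite setIACA E12 set0I.
Qed.

(** Each consistency identity holds almost surely by uniqueness of versions. There are only
    countably many words, so all of them hold together almost surely. *)
Lemma consistent_cond_prob (W : {mfun Omega >-> bits})
    (q : seq bool -> SZ -> \bar R) :
  (forall s z, 0 <= q s z) -> (forall s z, q s z \is a fin_num) ->
  (forall s, cond_prob P Z (W @^-1` cyl s) (q s)) ->
  {ae P, forall w, consistent (fun s => fine (q s (Z w)))}.
Proof.
move=> q0 qfin qE.
have mW s : measurable (W @^-1` cyl s).
  by apply: measurable_mfun_preimage; exact: measurable_cyl.
have ae0 : {ae P, forall w, q [::] (Z w) = 1}.
  have h1 : cond_prob P Z (W @^-1` cyl [::]) (cst 1).
    by rewrite cyl_nil preimage_setT; exact: cond_prob_setT.
  exact: (cond_prob_unique (mW [::]) (qE [::]) h1).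
have aeS s : {ae P, forall w,
    q s (Z w) = q (false :: s) (Z w) + q (true :: s) (Z w)}.
  suff hS : cond_prob P Z (W @^-1` cyl s) (q (false :: s) \+ q (true :: s)).
    exact: (cond_prob_unique (mW s) (qE s) hS).
  rewrite (_ : W @^-1` cyl s = W @^-1` cyl (false :: s) `|`
    W @^-1` cyl (true :: s)).
    apply: cond_probU => //.
    rewrite !cyl_cons -preimage_setI setIACA setIid; apply/seteqP; split=> // w.
    by rewrite /= => -[_ [->]].
  rewrite -preimage_setU !cyl_cons -setIUr.
  apply/seteqP; split=> w /=; last by case.
  by move=> ws; split => //; case: (W w _); [right|left].
apply: filterS2 ae0 (ae_forall_countType aeS) => w w0 wS; split=> [|s|s].
- by rewrite w0.
- exact: fine_ge0.
- by rewrite wS fineD.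
Qed.

(** The conditional probabilities of the cylinders of the coded variable [W] serve as masses for the
    bisection, and [c'] carries the resulting law back to [SF]. *)
Lemma reg_cond_dist_exists df (SF : measurableType df)
    (F : {mfun Omega >-> SF}) :
  bits_retract SF -> exists k, reg_cond_dist P F Z k.
Proof.
move=> [b [c [mb mc bK]]].
pose b' : {mfun SF >-> bits} := HB.pack b (isMeasurableFun.Build _ _ _ _ b mb).
pose c' : {mfun bits >-> SF} := HB.pack c (isMeasurableFun.Build _ _ _ _ c mc).
pose W : {mfun Omega >-> bits} := (b' \o F : {mfun _ >-> _}).
have mW s : measurable (W @^-1` cyl s).
  by apply: measurable_mfun_preimage; exact: measurable_cyl.
have /choice[q qP] s := cond_prob_pull_out P Z (mW s).
have q0 s z : 0 <= q s z by have [] := qP s.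
have qfin s z : q s z \is a fin_num by have [] := qP s.
have qE s : cond_prob P Z (W @^-1` cyl s) (q s) by have [] := qP s.
pose m z s := fine (q s z).
have mm s : measurable_fun setT (m ^~ s).
  by apply: measurableT_comp => //; have [] := qE s.
have mk : measurable_fun setT (fun z => bisect_law c' (m z) : Pspace SF R).
  exact: measurable_bisect_law.
exists (fun z => bisect_law c' (m z)); split=> // A mA; split.
  exact: (measurableT_comp (measurable_Pspace_ev mA) mk).
move=> B mB.
have mZB := measurable_mfun_preimage Z mB.
pose code (wu : Omega * R) : bits := bisect (m (Z wu.1)) wu.2.
have mcode : measurable_fun setT code.
  apply: (@measurable_bisect _ _ _ (fun w => m (Z w))) => s.
  exact: (measurableT_comp (mm s)).
have mZBT : measurable (Z @^-1` B `*` [set: R]) by exact: measurableX.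
(* Restricting to the event that [Z] lies in [B], draw a uniform point independently and record the
   bisected sequence; by Fubini, the masses of [nu] are the integrals to be computed. *)
pose nu : {measure set bits -> \bar R} :=
  pushforward (mrestr (P \x @unit_lebesgue R) mZBT) code.
have nuE D : measurable D ->
    nu mcode D = \int[P]_(w in Z @^-1` B)
      unit_lebesgue (bisect (m (Z w)) @^-1` D).
  move=> mD; rewrite /nu /= /pushforward /mrestr /= /product_measure1 /=.
  rewrite [RHS]integral_mkcond; apply: eq_integral => w _.
  rewrite patchE; case: ifPn => [/set_mem Zw|/negP Zw] /=.
    congr unit_lebesgue; apply/seteqP; split=> u; rewrite /xsection /= inE /=.
      by case.
    by split.
  rewrite (_ : xsection _ _ = set0) ?measure0//; apply/seteqP; split=> // u.
  by rewrite /xsection /= inE /= => -[_ [/mem_set]].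
have mcA : measurable (c @^-1` A) by exact: (measurable_mfun_preimage c').
transitivity (nu mcode (c @^-1` A)).
  by rewrite nuE//; apply: eq_integral => w _; rewrite bisect_lawE.
(* The roles are exchanged in this [event_law]: the event is that of [Z] in [B], the variable is
   [W]. Equality on cylinders will extend to all measurable sets. *)
have nucyl s : nu mcode (cyl s) = event_law P W mZB (cyl s).
  rewrite nuE; last exact: measurable_cyl.
  have [_ /(_ B mB)] := qE s.
  rewrite /= /event_law /pushforward /mrestr /= => <-.
  apply: ae_eq_integral => //.
  - apply: measurable_funTS.
    exact: (measurableT_comp (measurable_bisect_mass mm (measurable_cyl s))).
  - by apply: measurable_funTS; apply: measurableT_comp => //; have [] := qE s.
  - apply: filterS (consistent_cond_prob q0 qfin qE) => w cw _.
    by rewrite bisect_lawE_cyl// fineK.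
rewrite (bits_measure_unique _ nucyl)//.
  rewrite /= /event_law /pushforward /mrestr /=; congr (P (_ `&` _)).
  by apply/seteqP; split=> w /=; rewrite bK.
rewrite nuE//; apply: (@le_lt_trans _ _ (\int[P]_(w in Z @^-1` B) 1)).
  apply: ge0_le_integral => //.
    apply: measurable_funTS.
    exact: (measurableT_comp (measurable_bisect_mass mm (@measurableT _ bits))).
  move=> w _; apply: probability_le1.
  by rewrite preimage_setT; exact: measurableT.
rewrite integral_cst// mul1e.
by apply: le_lt_trans (probability_le1 P mZB) _; exact: ltry.
Qed.

End reg_cond_dist_exists.

(** * Rules for conditional probabilities *)

Section cond_prob_calculus.
Context d (Omega : measurableType d) (R : realType) (P : probability Omega R).

(** The tower property for a version that already factors through [phi]: the coarser variable only
    asks for fewer test sets. *)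
Lemma cond_prob_map dz (SZ : measurableType dz) dy (SY : measurableType dy)
    (Z : Omega -> SZ) (phi : SZ -> SY) E (h : SY -> \bar R) :
  measurable_fun setT phi -> measurable_fun setT h ->
  cond_prob P Z E (h \o phi) -> cond_prob P (phi \o Z) E h.
Proof.
move=> mphi mh [_ hE]; split=> // B mB.
by apply: (hE (phi @^-1` B)); rewrite -[X in measurable X]setTI; exact: mphi.
Qed.

Lemma cond_prob_indic dz (SZ : measurableType dz) (Z : Omega -> SZ) E p B :
  measurable B -> cond_prob P Z E p ->
  cond_prob P Z (E `&` Z @^-1` B) (fun z => p z * (\1_B z)%:E).
Proof.
move=> mB [mp pE]; split.
  apply: emeasurable_funM => //; apply/measurable_EFinP.
  exact: measurable_indic.
move=> D mD; rewrite -setIA -preimage_setI -pE; last exact: measurableI.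
rewrite setIC preimage_setI integral_mkcondr; apply: eq_integral => w _.
rewrite patchE /= indicE; case: ifPn => [/set_mem Bw|/negP Bw].
  by rewrite mem_set// mule1.
by rewrite memNset ?mule0// => Bw'; apply: Bw; exact: mem_set.
Qed.

(** A Dynkin argument: rectangles are stable under intersection and generate the product
    sigma-field, and the required identity passes to complements and disjoint countable unions. *)
Lemma cond_prob_rect d1 (S1 : measurableType d1) d2 (S2 : measurableType d2)
    (Z1 : {mfun Omega >-> S1}) (Z2 : {mfun Omega >-> S2}) E
    (h : S1 * S2 -> \bar R) :
  measurable E -> measurable_fun setT h -> (forall z, 0 <= h z) ->
  (forall B1 B2, measurable B1 -> measurable B2 ->
    \int[P]_(w in Z1 @^-1` B1 `&` Z2 @^-1` B2) h (Z1 w, Z2 w) =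
    P (E `&` (Z1 @^-1` B1 `&` Z2 @^-1` B2))) ->
  cond_prob P (fun w => (Z1 w, Z2 w)) E h.
Proof.
move=> mE mh h0 hE; set Z := fun w => (Z1 w, Z2 w).
have mZ : measurable_fun setT Z by exact: measurable_fun_pair.
have mZB B : measurable B -> measurable (Z @^-1` B).
  by move=> mB; rewrite -[X in measurable X]setTI; exact: mZ.
have mhZ D : measurable_fun D (h \o Z).
  by apply: measurable_funTS; exact: measurableT_comp.
have hT : \int[P]_w h (Z w) = P E.
  by have := hE _ _ measurableT measurableT; rewrite !preimage_setT setTI setIT.
split=> // B mB.
have : <<s [set A `*` B | A in @measurable _ S1 & B in @measurable _ S2] >> B.
  by rewrite -measurable_prod_measurableType.
apply: (@dynkin_induction _ (S1 * S2)%type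
  [set A `*` B | A in @measurable _ S1 & B in @measurable _ S2]
  (fun B => \int[P]_(w in Z @^-1` B) h (Z w) = P (E `&` Z @^-1` B))).
- by rewrite measurable_prod_measurableType.
- move=> _ _ [A1 mA1 [A2 mA2 <-]] [B1 mB1 [B2 mB2 <-]].
  exists (A1 `&` B1); first exact: measurableI.
  by exists (A2 `&` B2); [exact: measurableI|rewrite setXI].
- by rewrite preimage_setT setIT.
- by move=> _ [A1 mA1 [A2 mA2 <-]]; exact: hE.
- move=> S mS SE; have mZS := mZB _ mS.
  have ST : Z @^-1` S `|` Z @^-1` (~` S) = setT by exact: setUCr.
  have ES : E = (E `&` Z @^-1` S) `|` (E `&` Z @^-1` (~` S)).
    by rewrite -setIUr ST setIT.
  have : P (E `&` Z @^-1` S) + \int[P]_(w in Z @^-1` (~` S)) h (Z w) =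
      P (E `&` Z @^-1` S) + P (E `&` Z @^-1` (~` S)).
    have <- : P E = P (E `&` Z @^-1` S) + P (E `&` Z @^-1` (~` S)).
      rewrite [in LHS]ES; apply: measureU.
      + exact: measurableI.
      + by apply: measurableI => //; apply: mZB; exact: measurableC.
      + by apply/seteqP; split=> // w [[_ Sw] [_ nSw]]; exact: nSw.
    rewrite -hT -SE -ge0_integral_setU//.
    + by rewrite ST.
    + by apply: mZB; exact: measurableC.
    + by apply/disj_setPS => w [Sw]; exact.
  (* Finiteness permits the cancellation of this term in the extended reals. *)
  have fS : P (E `&` Z @^-1` S) \is a fin_num.
    by apply: fin_num_measure; exact: measurableI.
  set a := P (E `&` Z @^-1` S) in fS *; set b := P _; set I := integral _ _ _.
  by move=> /(congr1 (fun y => y - a)); rewrite (addeC a I) (addeC a b) !addeK.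
- move=> F mF tF FE.
  have tZF : trivIset setT (fun n => Z @^-1` F n).
    apply/trivIsetP => i j _ _ ij; rewrite -preimage_setI.
    by move/trivIsetP : tF => ->//; rewrite preimage_set0.
  rewrite preimage_bigcup ge0_integral_bigcup//; last first.
    by move=> n; exact: mZB.
  rewrite setI_bigcupr measure_bigcup//=; last 2 first.
  + by move=> n _; apply: measurableI => //; exact: mZB.
  + exact: trivIset_setIl.
  apply/congr_lim/funext => n; apply: eq_big => [i|i _]; last exact: FE.
  by rewrite in_setT.
Qed.

(** Conditional independence in its other form: conditioning on [V] as well leaves the law of [U]
    unchanged. On a rectangle, the event of [V] is replaced by the factor [q], then [k] by [p]
    almost surely, and the product version applies. *)
Lemma cond_indep_cond_prob du (SU : measurableType du)
    dv (SV : measurableType dv) dz (SZ : measurableType dz) (U : {mfun Omega >-> SU})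
    (V : {mfun Omega >-> SV}) (Z : {mfun Omega >-> SZ}) A k :
  cond_indep P U V Z -> measurable A -> (forall z, 0 <= k z) ->
  cond_prob P Z (U @^-1` A) k ->
  cond_prob P (fun w => (Z w, V w)) (U @^-1` A) (k \o fst).
Proof.
move=> UV mA k0 kE; have mUA := measurable_mfun_preimage U mA.
have [mk _] := kE.
apply: cond_prob_rect => [//||z|D B mD mB] /=.
- exact: measurableT_comp.
- exact: k0.
have mVB := measurable_mfun_preimage V mB.
have [p [q [pE qE [mpq pqE]]]] := UV A B mA mB.
rewrite -(cond_prob_pull_outE mVB qE mk k0 mD) (setIC (Z @^-1` D)) setIA -pqE//.
apply: ae_eq_integral; first exact: measurable_mfun_preimage.
- apply: measurable_funTS; have [mq _] := qE.
  by apply: emeasurable_funM; exact: measurableT_comp.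
- by apply: measurable_funTS; exact: (measurableT_comp mpq).
- by apply: filterS (cond_prob_unique mUA kE pE) => w -> _.
Qed.

End cond_prob_calculus.

(** Countably many values determine a measure, so countably many almost sure identities will give
    almost sure equality of random measures. *)
Lemma pmeas_cyl_ext (R : realType) d (T : measurableType d) (b : T -> bits)
    (c : bits -> T) (mu nu : pmeas T R) : measurable_fun setT b ->
  measurable_fun setT c -> cancel b c ->
  (forall s, mu (b @^-1` cyl s) = nu (b @^-1` cyl s)) -> mu = nu.
Proof.
move=> mb mc bK munu.
pose b' : {mfun T >-> bits} := HB.pack b (isMeasurableFun.Build _ _ _ _ b mb).
pose c' : {mfun bits >-> T} := HB.pack c (isMeasurableFun.Build _ _ _ _ c mc).
rewrite -(@bisect_law_id R _ T c' b' mu)// -(@bisect_law_id R _ T c' b' nu)//.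
by congr bisect_law; apply/funext => s; rewrite /= munu.
Qed.

(** * Sufficiency and minimality of the conditional law *)

Section conditional_law.
Context d (Omega : measurableType d) (R : realType) (P : probability Omega R).
Context dc (SC : measurableType dc) dx (SX : measurableType dx)
  df (SF : measurableType df).
Variables (C : {mfun Omega >-> SC}) (X : {mfun Omega >-> SX})
  (F : {mfun Omega >-> SF}).
Hypothesis SF_retract : bits_retract SF.
Variable kXC : SX * SC -> Pspace SF R.
Hypothesis kXCP : reg_cond_dist P F (fun w => (X w, C w)) kXC.

Let S : Omega -> Pspace SF R := fun w => kXC (X w, C w).

Let XC : {mfun Omega >-> (SX * SC)%type} :=
  HB.pack (fun w => (X w, C w)) (isMeasurableFun.Build _ _ _ _ _
    (measurable_fun_pair (@measurable_funPT _ _ _ _ X)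
                         (@measurable_funPT _ _ _ _ C))).

Lemma measurable_cond_law : measurable_fun setT S.
Proof. exact: (measurableT_comp kXCP.1 (@measurable_funPT _ _ _ _ XC)). Qed.

(** An event of [S] is an event of [XC], so its indicator is a version of its conditional
    probability and factors out of any intersection. *)
Lemma cond_law_admissible : admissible P C X F S.
Proof.
split.
- by apply: bits_retract_standard_borel; exact: bits_retract_Pspace.
- exact: measurable_cond_law.
move=> A B mA mB; have mkB : measurable (kXC @^-1` B).
  by rewrite -[X in measurable X]setTI; exact: kXCP.1.
exists (fun z => kXC z A), (fun z => cst 1 z * (\1_(kXC @^-1` B) z)%:E); split.
- exact: kXCP.2.
- by have := cond_prob_indic mkB (cond_prob_setT P XC); rewrite setTI.
- have := cond_prob_indic mkB (kXCP.2 A mA).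
  rewrite (_ : (fun z => kXC z A * (\1_(kXC @^-1` B) z)%:E) =
    (fun z => kXC z A * (cst 1 z * (\1_(kXC @^-1` B) z)%:E)))//.
  by apply/funext => z; rewrite mul1e.
Qed.

(** The version [kXC z A] depends on [z] only through [phi z], so evaluation at [A] is also a
    version given [S] and [C]. After pulling it out, the identity to check is the defining one of
    [kXC] on an event of [XC]. *)
Lemma cond_law_sufficient : predictively_sufficient P C X F S.
Proof.
move=> A B mA mB; have mXB := measurable_mfun_preimage X mB.
pose phi z : Pspace SF R * SC := (kXC z, z.2).
have mphi : measurable_fun setT phi.
  by apply: measurable_fun_pair => //; exact: kXCP.1.
pose SC' : {mfun Omega >-> (Pspace SF R * SC)%type} :=
  HB.pack (phi \o XC) (isMeasurableFun.Build _ _ _ _ _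
    (measurableT_comp mphi (@measurable_funPT _ _ _ _ XC))).
have mev : measurable_fun setT (fun z : Pspace SF R * SC => z.1 A).
  exact: (measurableT_comp (measurable_Pspace_ev mA)).
have [q [q0 _ qE pull]] := cond_prob_pull_out P SC' mXB.
exists (fun z : Pspace SF R * SC => z.1 A), q; split => //.
  exact: (@cond_prob_map _ _ _ P _ _ _ _ XC phi _ _ mphi mev (kXCP.2 A mA)).
have [mq _] := qE; split; first exact: emeasurable_funM.
move=> D mD.
apply: etrans (pull (fun z => z.1 A) D mev (fun z => measure_ge0 _ _) mD) _.
have mD' : measurable (phi @^-1` D `&` fst @^-1` B).
  apply: measurableI; rewrite -[X in measurable X]setTI.
    exact: (mphi measurableT).
  exact: (measurable_fst measurableT).
rewrite -setIA [X in P (_ `&` X)]setIC.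
exact: ((kXCP.2 A mA).2 _ mD').
Qed.

Context dt (ST : measurableType dt) (T : Omega -> ST).
Hypotheses (T_adm : admissible P C X F T)
  (T_suff : predictively_sufficient P C X F T).


(** On each coded cylinder, both kernels give versions of the same conditional probability given
    [X], [C] and [T]: [kXC] by admissibility, [g] by predictive sufficiency, after [phi] reorders
    the variables. *)
Lemma cond_law_unique (g : ST * SC -> Pspace SF R) :
  reg_cond_dist P F (fun w => (T w, C w)) g ->
  {ae P, forall w, S w = g (T w, C w)}.
Proof.
move=> [mg gE]; have [_ mT FT] := T_adm.
pose T' : {mfun Omega >-> ST} := HB.pack T (isMeasurableFun.Build _ _ _ _ _ mT).
pose TC : {mfun Omega >-> (ST * SC)%type} :=
  HB.pack (fun w => (T w, C w)) (isMeasurableFun.Build _ _ _ _ _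
    (measurable_fun_pair mT (@measurable_funPT _ _ _ _ C))).
pose Z : {mfun Omega >-> (SX * SC * ST)%type} :=
  HB.pack (fun w => (XC w, T w)) (isMeasurableFun.Build _ _ _ _ _
    (measurable_fun_pair (@measurable_funPT _ _ _ _ XC) mT)).
pose phi (z : ST * SC * SX) : SX * SC * ST := ((z.2, z.1.2), z.1.1).
have mphi : measurable_fun setT phi.
  apply: measurable_fun_pair; last exact: measurableT_comp.
  by apply: measurable_fun_pair => //; exact: measurableT_comp.
have [b [c [mb mc bK]]] := SF_retract.
suff aeg s : {ae P, forall w, S w (b @^-1` cyl s) =
                              g (T w, C w) (b @^-1` cyl s)}.
  apply: filterS (ae_forall_countType aeg) => w wg.
  exact: (pmeas_cyl_ext mb mc bK wg).
have mA : measurable (b @^-1` cyl s).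
  by rewrite -[X in measurable X]setTI; apply: mb => //; exact: measurable_cyl.
have k1 := cond_indep_cond_prob (U := F) (V := T') (Z := XC) FT mA
  (fun z => measure_ge0 _ _) (kXCP.2 _ mA).
have k2 := cond_indep_cond_prob (U := F) (V := X) (Z := TC) T_suff mA
  (fun z => measure_ge0 _ _) (gE _ mA).
have mh : measurable_fun setT (fun z : SX * SC * ST =>
    g (z.2, z.1.2) (b @^-1` cyl s)).
  apply: (measurableT_comp (measurable_Pspace_ev mA)).
  apply: (measurableT_comp mg); apply: measurable_fun_pair => //.
  exact: measurableT_comp.
have k3 : cond_prob P Z (F @^-1` (b @^-1` cyl s))
    (fun z : SX * SC * ST => g (z.2, z.1.2) (b @^-1` cyl s)).
  apply: (@cond_prob_map _ _ _ P _ _ _ _ (fun w => (TC w, X w)) phi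
    _ _ mphi mh).
  suff -> : (fun z : SX * SC * ST => g (z.2, z.1.2) (b @^-1` cyl s)) \o phi =
    (fun x => g x (b @^-1` cyl s)) \o fst by exact: k2.
  by apply/funext => -[[]].
have mFA := measurable_mfun_preimage F mA.
exact: (@cond_prob_unique _ _ _ P _ _ Z _ _ _ mFA k1 k3).
Qed.

Lemma cond_law_sigma_sub :
  sigma_sub_mod P (fun w => (S w, C w)) (fun w => (T w, C w)).
Proof.
have [_ mT _] := T_adm.
pose TC : {mfun Omega >-> (ST * SC)%type} :=
  HB.pack (fun w => (T w, C w)) (isMeasurableFun.Build _ _ _ _ _
    (measurable_fun_pair mT (@measurable_funPT _ _ _ _ C))).
have [g gE] := reg_cond_dist_exists P TC F SF_retract.
have mSC : measurable_fun setT (fun w => (S w, C w)).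
  by apply: measurable_fun_pair; [exact: measurable_cond_law|].
pose phi (z : ST * SC) : Pspace SF R * SC := (g z, z.2).
have mphi : measurable_fun setT phi.
  by apply: measurable_fun_pair => //; exact: gE.1.
move=> _ [D mD <-]; rewrite setTI.
have mphiD : measurable (phi @^-1` D).
  by rewrite -[X in measurable X]setTI; exact: mphi.
(* Replacing [S] by [g] of [T] and [C] yields an event of the pair (T, C); the two events differ
   only where [S] and its substitute differ, inside the null set [N]. *)
exists (TC @^-1` (phi @^-1` D)).
  by exists (phi @^-1` D) => //; rewrite setTI.
have [N [mN N0 SgN]] := cond_law_unique gE.
apply: (subset_measure0 _ mN _ N0).
  apply: measurableU; apply: measurableD.
  - by rewrite -[X in measurable X]setTI; exact: mSC.
  - exact: measurable_mfun_preimage.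
  - exact: measurable_mfun_preimage.
  - by rewrite -[X in measurable X]setTI; exact: mSC.
move=> w Dw; apply: SgN => Sg; move: Dw; rewrite /= /phi -Sg.
by case=> -[].
Qed.

End conditional_law.

Local Close Scope ereal_scope.

Theorem theorem1 (R : realType)
    (d dC dX dF : measure_display)
    (Omega : measurableType d) (P : probability Omega R)
    (SC : measurableType dC) (SX : measurableType dX) (SF : measurableType dF)
    (borelC : standard_borel R SC) (borelX : standard_borel R SX)
    (borelF : standard_borel R SF)
    (C : {RV P >-> SC}) (X : {RV P >-> SX}) (F : {RV P >-> SF})
    (kXC : SX * SC -> Pspace SF R)
    (kXC_version : reg_cond_dist P F (fun w => (X w, C w)) kXC) :
  let S : Omega -> Pspace SF R := fun w => kXC (X w, C w) in
  (admissible P C X F S /\ predictively_sufficient P C X F S) /\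
  (forall (dT : measure_display) (ST : measurableType dT) (T : Omega -> ST),
    admissible P C X F T -> predictively_sufficient P C X F T ->
    [/\ exists2 g : ST * SC -> Pspace SF R,
          measurable_fun setT g & {ae P, forall w, S w = g (T w, C w)},
        exists g : ST * SC -> Pspace SF R,
          reg_cond_dist P F (fun w => (T w, C w)) g,
        forall g : ST * SC -> Pspace SF R,
          reg_cond_dist P F (fun w => (T w, C w)) g ->
          {ae P, forall w, S w = g (T w, C w)} &
        sigma_sub_mod P (fun w => (S w, C w)) (fun w => (T w, C w))]).
Proof.
move=> S; have SF_retract := standard_borel_bits_retract borelF.
split; first split.
- exact: cond_law_admissible.
- exact: cond_law_sufficient.
move=> dT ST T T_adm T_suff; have [_ mT _] := T_adm.
have [g gE] : exists g : ST * SC -> Pspace SF R,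
    reg_cond_dist P F (fun w => (T w, C w)) g.
  pose TC : {mfun Omega >-> (ST * SC)%type} :=
    HB.pack (fun w => (T w, C w)) (isMeasurableFun.Build _ _ _ _ _
      (measurable_fun_pair mT (@measurable_funPT _ _ _ _ C))).
  exact: (reg_cond_dist_exists P TC F SF_retract).
have uniq g' := cond_law_unique SF_retract kXC_version T_adm T_suff (g := g').
split; [by exists g; [exact: gE.1|exact: uniq]|by exists g|exact: uniq|].
exact: (cond_law_sigma_sub SF_retract kXC_version T_adm T_suff).
Qed.
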